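(* Consider a uniform Cartesian stratification $\mathcal{S}$ of $\mathfrak{U}=[0,1]^n\subset\mathbb{R}^n$. (i) If $f\in C^1(\mathfrak{U})$, then the variance of the hybrid stratification estimator satisfies $$V_{\alpha} \le \frac{n C}{3\, N}\, \lvert \mathcal{S} \rvert^{-2/n} \min\left(\frac{1}{\alpha}, \frac{1}{1-\alpha}\right)\le \frac{2 n C}{3\, N}\, \lvert \mathcal{S} \rvert^{-2/n}$$ for any $\alpha\in[0,1]$, where $C = \sup_{\mathbf{u}\in\mathfrak{U}}\Vert \nabla f(\mathbf{u})\Vert_2^2 \le \Vert f\Vert_{C^1(\mathfrak{U})}^2$. (ii) If $f\colon \mathfrak{U}\to\mathbb{R}$ is a piecewise constant function with a jump discontinuity of size $\delta>0$ across a curve $\Gamma$ in $\mathfrak{U}$, then the stratification estimator's variance is bounded by $$V_{\alpha} \le \frac{\delta^2}{4\,N} \begin{cases} \dfrac{\lvert \mathcal{T} \rvert}{\lvert \mathcal{S} \rvert}, & \alpha = 0,\\[2mm] \dfrac{\lvert \mathcal{T}\rvert}{\lvert \mathcal{S}\rvert}\, \min\left\{\dfrac{1}{1-\alpha}, \dfrac{1}{\alpha}\, \dfrac{\lvert \mathcal{T}\rvert}{\lvert \mathcal{S}\rvert}\right\}, & 0<\alpha < 1,\\[2mm] \left(\dfrac{\lvert \mathcal{T} \rvert}{\lvert \mathcal{S} \rvert}\right)^2, & \alpha=1, \end{cases}$$ where $\mathcal{T}\subset\mathcal{S}$ denotes the set of all strata that contain $\Gamma$ (i.e. that have nonempty intersection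 with $\Gamma$).
   Context: Let $\mathbf{Y}$ be uniformly distributed on $\mathfrak{U}=[0,1]^n$ and $Q=f(\mathbf{Y})$. A stratification $\mathcal{S}$ of $\mathfrak{U}$ is a finite collection of pairwise disjoint measurable sets (strata) with union $\mathfrak{U}$. A uniform Cartesian stratification is one obtained by dividing $[0,1]^n$ into $|\mathcal{S}|=m^n$ congruent axis-parallel cubes of side length $1/m=|\mathcal{S}|^{-1/n}$ (with boundary faces assigned to one of the adjacent cubes so that strata are disjoint), so $p_S:=\mathbb{P}(\mathbf{Y}\in S)=1/|\mathcal{S}|$ for all $S\in\mathcal{S}$. Let $\sigma_S^2=\mathrm{Var}(f(\mathbf{Y})\mid\mathbf{Y}\in S)$, $\sigma_S\ge0$, and $\overline{\sigma}_S=\sigma_S/\sum_{T\in\mathcal{S}}p_T\sigma_T$. For $\alpha\in[0,1]$ the hybrid stratification estimator $\hat Q_\alpha=\sum_{S\in\mathcal{S}}\frac{p_S}{N_S^\alpha}\sum_{j=1}^{N_S^\alpha}Q_S^{(j)}$ uses a total of $N$ samples, with $N_S^\alpha=p_SN(1+\alpha(\overline{\sigma}_S-1))$ samples $Q_S^{(j)}$ in stratum $S$, all samples being independent and $Q_S^{(j)}$ having the conditional law of $f(\mathbf{Y})$ given $\mathbf{Y}\in S$. Treating the $N_S^\alpha$ as continuous variables (ignoring rounding), its variance is $$V_\alpha=\frac1N\sum_{S\in\mathcal{S}}\frac{p_S\sigma_S^2}{1+\alpha(\overline{\sigma}_S-1)},$$ where terms with $\sigma_S=0$ are taken to be $0$;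 thus $V_0=\frac1N\sum_Sp_S\sigma_S^2$, $V_1=\frac1N\bigl(\sum_Sp_S\sigma_S\bigr)^2$, and $V_\alpha=0$ if all $\sigma_S=0$. In (i), $1/0$ is read as $+\infty$, and $\|f\|_{C^1(\mathfrak{U})}=\sup_{\mathfrak{U}}|f|+\sup_{\mathfrak{U}}\|\nabla f\|_2$. In (ii), ''piecewise constant with a jump of size $\delta$ across $\Gamma$'' means: $\Gamma\subset\mathfrak{U}$ is the interface (a curve if $n=2$, a hypersurface in general) across which $f$ jumps, $f$ is locally constant on $\mathfrak{U}\setminus\Gamma$, and $f$ takes only two values, which differ by $\delta$ in absolute value. *)

(* Defs.v *)
From HB Require Import structures.
From mathcomp Require Import all_boot all_order all_algebra.
From mathcomp Require Import all_classical all_reals all_analysis.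
Import Order.TTheory GRing.Theory Num.Theory.
Import numFieldNormedType.Exports.

Set Implicit Arguments.
Unset Strict Implicit.
Unset Printing Implicit Defensive.

Local Open Scope classical_set_scope.
Local Open Scope ring_scope.

(* R^n with its Borel sigma-algebra *)
Notation borel_rV R n := (g_sigma_algebraType (@open 'rV[R]_n)).

Definition unit_cube (R : realType) (n : nat) : set 'rV[R]_n :=
  [set u | forall i, 0 <= u ord0 i <= 1].

(* The library norm on 'rV[R]_n is the sup norm. *)
Definition dotprod (R : realType) (n : nat) (u v : 'rV[R]_n) : R :=
  \sum_i u ord0 i * v ord0 i.

Definition norm2 (R : realType) (n : nat) (u : 'rV[R]_n) : R :=
  Num.sqrt (dotprod u u).

(* f v = f u + <g, v - u> + o(v - u) as v tends to u inside U; at points of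
   the boundary of U only the values of f on U matter. *)
Definition is_gradient (R : realType) (n : nat) (U : set 'rV[R]_n)
    (f : 'rV[R]_n -> R) (u g : 'rV[R]_n) : Prop :=
  let F := within U (nbhs u) in
  (fun v => f v - f u - dotprod g (v - u)) =o_F (fun v => v - u).

(* On the unit cube a gradient is unique when it exists: from any point one
   can move inside the cube along each coordinate axis. The value 0 is a
   dummy where no gradient exists. *)
Definition gradient (R : realType) (n : nat) (U : set 'rV[R]_n)
    (f : 'rV[R]_n -> R) (u : 'rV[R]_n) : 'rV[R]_n :=
  xget 0 [set g | is_gradient U f u g].

Definition C1 (R : realType) (n : nat) (U : set 'rV[R]_n)
    (f : 'rV[R]_n -> R) : Prop :=
  (forall u, U u -> exists g, is_gradient U f u g) /\
  {within U, continuous (gradient U f)}.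

Definition sup_grad2 (R : realType) (n : nat) (U : set 'rV[R]_n)
    (f : 'rV[R]_n -> R) : R :=
  sup [set norm2 (gradient U f u) ^+ 2 | u in U].

Definition C1_norm (R : realType) (n : nat) (U : set 'rV[R]_n)
    (f : 'rV[R]_n -> R) : R :=
  sup [set `|f u| | u in U] + sup [set norm2 (gradient U f u) | u in U].

(* The law of Y is the uniform distribution on the unit cube; it is determined
   by the probabilities of closed boxes inside the cube. The box a = 0, b = 1
   gives P (Y in unit_cube) = 1. *)
Definition uniform_on_cube (d : measure_display) (T : measurableType d)
    (R : realType) (P : probability T R) (n : nat) (Y : T -> 'rV[R]_n) : Prop :=
  measurable_fun setT (Y : T -> borel_rV R n) /\
  forall a b : 'rV[R]_n,
    (forall i, 0 <= a ord0 i /\ a ord0 i <= b ord0 i /\ b ord0 i <= 1) ->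
    P [set w | forall i, a ord0 i <= Y w ord0 i <= b ord0 i] =
    (\prod_i (b ord0 i - a ord0 i))%:E.

(* A finite collection of strata is presented as a family over a finType. *)
Definition stratification (R : realType) (n : nat) (I : finType)
    (U : set 'rV[R]_n) (S : I -> set 'rV[R]_n) : Prop :=
  [/\ forall k, measurable (S k : set (borel_rV R n)),
      trivIset setT S &
      \bigcup_k S k = U].

Definition closed_cell (R : realType) (n m : nat) (k : {ffun 'I_n -> 'I_m}) :
    set 'rV[R]_n :=
  [set u | forall i, (k i)%:R / m%:R <= u ord0 i <= (k i).+1%:R / m%:R].

Definition open_cell (R : realType) (n m : nat) (k : {ffun 'I_n -> 'I_m}) :
    set 'rV[R]_n :=
  [set u | forall i, (k i)%:R / m%:R < u ord0 i < (k i).+1%:R / m%:R].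

(* m ^ n cubes of side 1 / m; the points of the common faces may be
   distributed among the adjacent cubes in any measurable way. *)
Definition uniform_cartesian (R : realType) (n m : nat)
    (S : {ffun 'I_n -> 'I_m} -> set 'rV[R]_n) : Prop :=
  stratification (@unit_cube R n) S /\
  forall k, open_cell k `<=` S k /\ S k `<=` closed_cell k.

(* conditional expectation and variance given an event of positive
   probability *)
Definition cond_mean (d : measure_display) (T : measurableType d)
    (R : realType) (P : probability T R) (A : set T) (X : T -> R) : R :=
  (\int[P]_(w in A) X w) / fine (P A).

Definition cond_var (d : measure_display) (T : measurableType d)
    (R : realType) (P : probability T R) (A : set T) (X : T -> R) : R :=
  cond_mean P A (fun w => (X w - cond_mean P A X) ^+ 2).

Definition stratum_prob (d : measure_display) (T : measurableType d)
    (R : realType) (P : probability T R) (n : nat) (Y : T -> 'rV[R]_n)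
    (S : set 'rV[R]_n) : R :=
  fine (P (Y @^-1` S)).

Definition stratum_sd (d : measure_display) (T : measurableType d)
    (R : realType) (P : probability T R) (n : nat) (Y : T -> 'rV[R]_n)
    (f : 'rV[R]_n -> R) (S : set 'rV[R]_n) : R :=
  Num.sqrt (cond_var P (Y @^-1` S) (f \o Y)).

(* sigma_S / sum_T p_T sigma_T *)
Definition rel_sd (d : measure_display) (T : measurableType d)
    (R : realType) (P : probability T R) (n : nat) (Y : T -> 'rV[R]_n)
    (f : 'rV[R]_n -> R) (I : finType) (S : I -> set 'rV[R]_n) (k : I) : R :=
  stratum_sd P Y f (S k) /
  \sum_(j : I) stratum_prob P Y (S j) * stratum_sd P Y f (S j).

(* Variance of the hybrid estimator with (real) sample counts
   p_S N (1 + alpha (rel_sd_S - 1)) in each stratum. A summand with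
   sigma_S = 0 is 0 even when its denominator vanishes, as x / 0 = 0. *)
Definition hybrid_variance (d : measure_display) (T : measurableType d)
    (R : realType) (P : probability T R) (n : nat) (Y : T -> 'rV[R]_n)
    (f : 'rV[R]_n -> R) (I : finType) (S : I -> set 'rV[R]_n) (N : nat)
    (alpha : R) : R :=
  N%:R^-1 * \sum_(k : I)
    stratum_prob P Y (S k) * stratum_sd P Y f (S k) ^+ 2 /
    (1 + alpha * (rel_sd P Y f S k - 1)).

(* f jumps by delta across Gamma. No regularity of Gamma (closedness,
   dimension) is imposed. *)
Definition piecewise_constant (R : realType) (n : nat) (U : set 'rV[R]_n)
    (f : 'rV[R]_n -> R) (Gamma : set 'rV[R]_n) (delta : R) : Prop :=
  [/\ Gamma `<=` U,
      forall u, (U `\` Gamma) u ->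
        \forall v \near within (U `\` Gamma) (nbhs u), f v = f u &
      exists a b : R, `|a - b| = delta /\ f @` U = [set a; b]].

Definition hit_strata (R : realType) (n : nat) (I : finType)
    (S : I -> set 'rV[R]_n) (Gamma : set 'rV[R]_n) : {set I} :=
  [set k | `[< S k `&` Gamma !=set0 >]]%SET.

(* Main.v *)
Require Import Defs.
From HB Require Import structures.
From mathcomp Require Import all_boot all_order all_algebra.
From mathcomp Require Import all_classical all_reals all_analysis.
From mathcomp Require Import measurable_realfun ring lra.
Import Order.TTheory GRing.Theory Num.Theory.
Import numFieldNormedType.Exports.

Local Open Scope classical_set_scope.
Local Open Scope ring_scope.

(** Each stratum carries the same probability [1/|S|]: it lies in a closed cell
    of that volume, and the strata together exhaust the cube, so none of the
    inequalities [p_S <= 1/|S|] can be strict ([prob_stratum]).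

    If [f] stays within distance [K] of some constant [c] on a stratum, then
    [sigma_S <= K] ([cond_var_le], [stratum_sd_le]). For [f] of class C^1, take
    [c] to be the value at the center of the cell. The cell is star-shaped about
    its center even after its boundary has been shared out arbitrarily, so the
    mean value theorem along a segment ([segment_MVT]) and Cauchy-Schwarz give
    [(f u - c)^2 <= C |u - center|^2 <= n C / (4 m^2)], which is below the
    required [n C / (3 m^2)]. For [f] with two values at distance [delta], take
    [c] halfway between them, so that [K = delta / 2]; on a stratum that misses
    the interface the same mean value argument with zero gradient shows that
    [f] is constant and [sigma_S = 0].

    It remains to sum. Write [sigma] for the relative deviation [rel_sd] and [M]
    for the mean deviation. The sampling weight
    [1 + alpha (sigma - 1) = (1 - alpha) + alpha sigma] is at least each of its
    two summands. Dropping the second compares [V_alpha] with proportional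
    allocation, [V_0 / (1 - alpha)]; dropping the first compares it with optimal
    allocation, [V_1 / alpha], since [sigma_S^2 / (alpha sigma_S / M)] is
    [sigma_S M / alpha]. Only strata with nonzero deviation contribute, which
    makes [|T|/|S|] appear once in the first bound and squared in the second
    ([hybrid_variance_le_proportional], [hybrid_variance_le_optimal]). *)

Set Implicit Arguments.
Unset Strict Implicit.

(** * The Euclidean scalar product *)

Lemma dotprod_ge0 (R : realType) (n : nat) (u : 'rV[R]_n) : 0 <= dotprod u u.
Proof. by apply: sumr_ge0 => i _; rewrite -expr2 sqr_ge0. Qed.

Lemma norm2_sqr (R : realType) (n : nat) (u : 'rV[R]_n) :
  norm2 u ^+ 2 = dotprod u u.
Proof. by rewrite sqr_sqrtr ?dotprod_ge0. Qed.

(** Expand the nonnegative square of [(v.v) u - (u.v) v]; the result is [v.v]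
    times the difference of the two sides. *)
Lemma dotprod_Cauchy_Schwarz (R : realType) (n : nat) (u v : 'rV[R]_n) :
  dotprod u v ^+ 2 <= dotprod u u * dotprod v v.
Proof.
have key (a b : R) : dotprod (a *: u - b *: v) (a *: u - b *: v) =
    a ^+ 2 * dotprod u u - 2 * a * b * dotprod u v + b ^+ 2 * dotprod v v.
  rewrite /dotprod !mulr_sumr -sumrB -big_split /=.
  by apply: eq_bigr => i _; rewrite !mxE; ring.
have [v0|vN0] := eqVneq (dotprod v v) 0.
  have -> : dotprod u v = 0.
    apply: big1 => i _.
    have /eqP := v0; rewrite psumr_eq0 => [/allP/(_ i)|j _]; last by rewrite -expr2 sqr_ge0.
    by rewrite mem_index_enum -expr2 sqrf_eq0 => /(_ isT)/eqP ->; rewrite mulr0.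
  by rewrite v0 mulr0 expr0n.
have v_gt0 : 0 < dotprod v v by rewrite lt_def vN0 dotprod_ge0.
have := dotprod_ge0 (dotprod v v *: u - dotprod u v *: v); rewrite key.
rewrite (_ : _ + _ = dotprod v v * (dotprod u u * dotprod v v - dotprod u v ^+ 2)); last by ring.
by rewrite pmulr_rge0// subr_ge0.
Qed.

Lemma cvg_dotprod (R : realType) (n : nat) (X : Type) (F : set_system X)
    (a b : X -> 'rV[R]_n) (u v : 'rV[R]_n) : Filter F ->
  a x @[x --> F] --> u -> b x @[x --> F] --> v ->
  dotprod (a x) (b x) @[x --> F] --> dotprod u v.
Proof.
move=> FF au bv.
apply: (@cvg_big _ _ +%R 0 xpredT (@add_continuous R) _ F) => i _.
have coord (w : 'rV[R]_n) : continuous_at w (fun x : 'rV[R]_n => x ord0 i).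
  exact: coord_continuous.
apply: cvgM; first exact: (@cvg_comp _ _ _ a (fun x => x ord0 i) _ _ _ au (coord u)).
exact: (@cvg_comp _ _ _ b (fun x => x ord0 i) _ _ _ bv (coord v)).
Qed.

(** * Gradients relative to a set *)

Lemma is_gradientP (R : realType) (n : nat) (U : set 'rV[R]_n)
    (f : 'rV[R]_n -> R) (u g : 'rV[R]_n) :
  is_gradient U f u g <-> forall e, 0 < e ->
    \forall v \near within U (nbhs u),
      `|f v - f u - dotprod g (v - u)| <= e * `|v - u|.
Proof. exact: (@eqoP _ _ _ _ (within_filter_on U (nbhs_filter_on u))). Qed.

Lemma is_gradient_continuous (R : realType) (n : nat) (U : set 'rV[R]_n)
    (f : 'rV[R]_n -> R) (u g : 'rV[R]_n) :
  is_gradient U f u g -> f v @[v --> within U (nbhs u)] --> f u.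
Proof.
move=> /is_gradientP grad.
have id_cvg : v - u @[v --> within U (nbhs u)] --> (0 : 'rV[R]_n).
  rewrite -[X in _ --> X](subrr u); apply: cvgB; last exact: cvg_cst.
  exact: cvg_within.
have dot_cvg : dotprod g (v - u) @[v --> within U (nbhs u)] --> (0 : R).
  have -> : 0 = dotprod g 0 by rewrite /dotprod big1// => i _; rewrite mxE mulr0.
  by apply: cvg_dotprod => //; exact: cvg_cst.
have rem_cvg : f v - f u - dotprod g (v - u) @[v --> within U (nbhs u)] --> (0 : R).
  apply: norm_cvg0; apply: (@squeeze_cvgr _ _ _ _ (fun=> 0) (fun v => `|v - u|)).
  - near=> v; rewrite normr_ge0/= -[leRHS]mul1r.
    by near: v; exact: grad.
  - exact: cvg_cst.
  - by rewrite -[X in _ --> X](@normr0 R 'rV[R]_n); apply: cvg_norm id_cvg.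
have sum_cvg : (f v - f u - dotprod g (v - u)) + dotprod g (v - u) + f u
    @[v --> within U (nbhs u)] --> 0 + 0 + f u.
  by apply: cvgD; [exact: cvgD|exact: cvg_cst].
rewrite !add0r in sum_cvg; apply: cvg_trans sum_cvg.
by apply: near_eq_cvg; near=> v; rewrite !subrK.
Unshelve. all: by end_near. Qed.

(** The one-variable mean value theorem for [f] restricted to the segment. At
    interior parameters a gradient relative to [A] suffices for a two-sided
    derivative, because the whole segment lies in [A]; this makes the lemma
    apply to closed cubes and to strata with ragged boundary alike. *)
Lemma segment_MVT (R : realType) (n : nat) (A : set 'rV[R]_n)
    (f : 'rV[R]_n -> R) (g : 'rV[R]_n -> 'rV[R]_n) (u v : 'rV[R]_n) :
  (forall x, A x -> is_gradient A f x (g x)) ->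
  (forall t : R, 0 <= t <= 1 -> A (u + t *: (v - u))) ->
  exists2 x, A x & f v - f u = dotprod (g x) (v - u).
Proof.
move=> grad seg; set w := v - u in seg *.
pose p (t : R) := u + t *: w.
have p_cvg (t : R) : p s @[s --> t] --> p t.
  by apply: cvgD; [exact: cvg_cst|apply: cvgZr_tmp; exact: cvg_id].
have p_within (t : R) : p s @[s --> within `[0, 1] (nbhs t)] --> within A (nbhs (p t)).
  move=> B /p_cvg; rewrite /= !nbhs_simpl/= => nearB.
  rewrite /within/=; near=> s => s01; have : (A (p s) -> B (p s)) by near: s.
  by apply; apply: seg; move: s01; rewrite /= in_itv.
have cont : {within `[0, 1], continuous (f \o p)}.
  apply/subspace_continuousP => t t01; apply: cvg_comp; first exact: p_within.
  apply: is_gradient_continuous; apply: grad; apply: seg.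
  by move: t01; rewrite /= in_itv.
have drv (t : R) : t \in `]0, 1[ -> is_derive t 1 (f \o p) (dotprod (g (p t)) w).
  move=> t01.
  have quot : h^-1 *: ((f \o p) (h *: 1 + t) - (f \o p) t) @[h --> 0^'] --> dotprod (g (p t)) w.
    apply/cvgrPdist_le => e e0.
    (* The remainder at [p (t + h)] is measured against [`|h| * `|w|]; the
       factor [1 + `|w|] absorbs [`|w|], also when the segment is a point. *)
    have e'0 : 0 < e / (1 + `|w|) by rewrite divr_gt0// ltr_pwDl.
    have nr : \forall s \near t, `|f (p s) - f (p t) - dotprod (g (p t)) (p s - p t)| <=
        e / (1 + `|w|) * `|p s - p t|.
      have /is_gradientP/(_ _ e'0)/p_within : is_gradient A f (p t) (g (p t)).
        by apply/grad/seg; move: t01; rewrite in_itv/= => /andP[/ltW-> /ltW->].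
      rewrite /= !nbhs_simpl/= => nr; near=> s.
      have : s \in `[0, 1] by apply: subset_itv_oo_cc; near: s; exact: near_in_itvoo.
      by near: s.
    have sh : h *: 1 + t @[h --> (0 : R)] --> t.
      rewrite -[X in _ --> X]add0r; apply: cvgD; last exact: cvg_cst.
      by rewrite -[X in _ --> X](scale0r (1 : R^o)); apply: cvgZr_tmp; exact: cvg_id.
    have nr0 := sh _ nr; rewrite /= nbhs_simpl/= in nr0.
    near=> h.
    have h0 : h != 0 by near: h; exact: nbhs_dnbhs_neq.
    have : `|f (p (h *: 1 + t)) - f (p t) - dotprod (g (p t)) (p (h *: 1 + t) - p t)| <=
        e / (1 + `|w|) * `|p (h *: 1 + t) - p t|.
      by near: h; exact: nbhs_dnbhs.
    have -> : p (h *: 1 + t) - p t = h *: w.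
      by rewrite /p [h *: 1]mulr1 scalerDl opprD addrACA subrr add0r addrK.
    have -> : dotprod (g (p t)) (h *: w) = h * dotprod (g (p t)) w.
      by rewrite /dotprod mulr_sumr; apply: eq_bigr => i _; rewrite !mxE mulrCA.
    rewrite normrZ => le.
    rewrite -(ler_pM2l (x := `|h|)) ?normr_gt0// -normrM mulrBr distrC.
    rewrite [_ *: _]/(_ * _) mulVKf//; apply: le_trans le _.
    rewrite mulrCA ler_pM2l ?normr_gt0// -mulrA ler_piMr ?(ltW e0)//.
    by rewrite mulrC ler_pdivrMr ?ltr_pwDl// mul1r lerDr.
  split; first by apply/cvg_ex; eexists; exact: quot.
  exact/cvg_lim.
have [t t01] := @MVT_segment R _ _ 0 1 ler01 drv cont.
rewrite subr0 mulr1 /= /p scale0r addr0 scale1r subrKC => ->.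
by exists (u + t *: w) => //; apply: seg; move: t01; rewrite in_itv.
Unshelve. all: by end_near. Qed.

(** * Conditional variance and strata probabilities *)

(** The variance is at most the mean square deviation from any constant [c].
    With [(X - c)^2 <= K], the square [(X - mu)^2] is pointwise bounded by an
    affine function of [X], whose conditional mean is [K - (mu - c)^2]. *)
Lemma cond_var_le (d : measure_display) (T : measurableType d) (R : realType)
    (P : probability T R) (A : set T) (X : T -> R) (c K : R) :
  measurable A -> 0 < fine (P A) -> measurable_fun A X ->
  (forall w, A w -> (X w - c) ^+ 2 <= K) -> cond_var P A X <= K.
Proof.
move=> mA PA_gt0 mX Xc.
have PA_fin : (P A < +oo)%E by rewrite ltey_eq fin_num_measure.
have integrable_bounded (f : T -> R) (M : R) : measurable_fun A f ->
    (forall w, A w -> `|f w| <= M) -> P.-integrable A (EFin \o f).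
  move=> mf fM; apply: measurable_bounded_integrable => //.
  exists M; split; first by rewrite num_real.
  by move=> x Mx w /= Aw; rewrite (le_trans (fM _ Aw))// ltW.
have X_le w : A w -> `|X w| <= K + 1 + `|c|.
  move=> Aw; rewrite -[X w](subrK c) (le_trans (ler_normD _ _))// lerD2r.
  have := Xc w Aw; rewrite -real_normK ?num_real//; set x := `|_|.
  by have := sqr_ge0 (x - 1); have := sqr_ge0 x; rewrite !expr2; nra.
have iX : P.-integrable A (EFin \o X) by apply: integrable_bounded X_le.
set mu := cond_mean P A X.
have intX : \int[P]_(w in A) X w = mu * fine (P A).
  by rewrite /mu /cond_mean divfK// gt_eqF.
rewrite /cond_var -/mu {1}/cond_mean ler_pdivrMr//.
have sq_le w : A w -> (X w - mu) ^+ 2 <= (2 * (c - mu)) * X w + (K - c ^+ 2 + mu ^+ 2).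
  by move=> Aw; rewrite -subr_ge0; have := Xc w Aw; rewrite -subr_ge0; congr (0 <= _); ring.
have i_cst (r : R) : P.-integrable A (EFin \o cst r).
  exact: (integrable_bounded _ `|r|).
have i_lin : P.-integrable A (EFin \o (fun w => 2 * (c - mu) * X w)).
  apply: (integrable_bounded _ (`|2 * (c - mu)| * (K + 1 + `|c|))).
    by apply: measurable_funM => //; exact: measurable_cst.
  by move=> w Aw; rewrite normrM ler_wpM2l// X_le.
apply: (@le_trans _ _ (\int[P]_(w in A) ((2 * (c - mu)) * X w + (K - c ^+ 2 + mu ^+ 2)))).
  apply: le_Rintegral => //.
    apply: (integrable_bounded _ (`|2 * (c - mu)| * (K + 1 + `|c|) + `|K - c ^+ 2 + mu ^+ 2|)).
      by apply: measurable_funX; apply: measurable_funB => //; exact: measurable_cst.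
    move=> w Aw; rewrite ger0_norm ?sqr_ge0// (le_trans (sq_le _ Aw))// lerD ?ler_norm//.
    by rewrite (le_trans (ler_norm _))// normrM ler_wpM2l// X_le.
  exact: (integrableD mA i_lin (i_cst (K - c ^+ 2 + mu ^+ 2))).
rewrite (RintegralD mA i_lin (i_cst (K - c ^+ 2 + mu ^+ 2))) (RintegralZl _ mA iX) intX.
rewrite (Rintegral_cst P mA (K - c ^+ 2 + mu ^+ 2)) mulrA -mulrDl ler_pM2r//.
by rewrite -subr_ge0; have := sqr_ge0 (mu - c); congr (0 <= _); ring.
Qed.

(** [Y] is Borel measurable and [f] continuous only on [U], so the preimage under
    [f] of an open interval is open relative to [U]. *)
Lemma measurable_comp_subspace (d : measure_display) (T : measurableType d)
    (R : realType) (n : nat) (Y : T -> 'rV[R]_n) (U B : set 'rV[R]_n)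
    (f : 'rV[R]_n -> R) :
  measurable_fun setT (Y : T -> borel_rV R n) ->
  {within U, continuous f} -> B `<=` U -> measurable (Y @^-1` B) ->
  measurable_fun (Y @^-1` B) (f \o Y).
Proof.
move=> mY /continuousP fU BU mYB.
apply: (measurability _ (RGenOpens.measurableE R)) => /=.
move=> _ [W [a [b ->]] <-].
have /open_subspaceP[V oV VU] := fU _ (interval_open (a := BRight a) (b := BLeft b) isT isT).
have -> : Y @^-1` B `&` (f \o Y) @^-1` `]a, b[ = Y @^-1` B `&` Y @^-1` V.
  apply/seteqP; split => w [/= YB h]; split => //.
    suff: (V `&` U) (Y w) by case.
    by rewrite VU; split => //; exact: BU.
  suff: (f @^-1` `]a, b[ `&` U) (Y w) by case.
  by rewrite -VU; split => //; exact: BU.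
apply: measurableI; [exact: mYB|rewrite -[Y @^-1` V]setTI; apply: mY => //].
exact: sub_sigma_algebra.
Qed.

Section Cells.
Variables (d : measure_display) (T : measurableType d) (R : realType).
Variables (P : probability T R) (n m : nat) (Y : T -> 'rV[R]_n).
Hypotheses (m_gt0 : (0 < m)%N) (Y_unif : uniform_on_cube P Y).

Lemma measurable_preimage (B : set 'rV[R]_n) :
  measurable (B : set (borel_rV R n)) -> measurable (Y @^-1` B).
Proof. by move=> mB; rewrite -[_ @^-1` _]setTI; apply: (Y_unif.1). Qed.

Let measurable_preimage_closed (B : set 'rV[R]_n) : closed B -> measurable (Y @^-1` B).
Proof.
move=> cB; rewrite -[B]setCK preimage_setC; apply: measurableC.
apply: (@measurable_preimage (~` B)); apply: sub_sigma_algebra.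
exact: closed_openC.
Qed.

Lemma closed_box_closed (a b : 'rV[R]_n) :
  closed [set u : 'rV[R]_n | forall i, a ord0 i <= u ord0 i <= b ord0 i].
Proof.
have -> : [set u : 'rV[R]_n | forall i, a ord0 i <= u ord0 i <= b ord0 i] =
    \bigcap_(i in [set: 'I_n]) ((fun u : 'rV[R]_n => u ord0 i) @^-1` `[a ord0 i, b ord0 i]).
  apply/seteqP; split => u /= h; first by move=> i _ /=; rewrite in_itv/= h.
  by move=> i; have := h i I; rewrite /= in_itv/=.
apply: closed_bigI => i _; apply: closed_comp; last exact: interval_closed.
by move=> u _; exact: coord_continuous.
Qed.

Lemma prob_closed_cell (k : {ffun 'I_n -> 'I_m}) :
  P (Y @^-1` closed_cell k) = ((m%:R^-1) ^+ n)%:E.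
Proof.
have m0 : 0 < m%:R :> R by rewrite ltr0n.
have := Y_unif.2 (\row_i ((k i)%:R / m%:R)) (\row_i ((k i).+1%:R / m%:R)).
under [X in P X = _]eq_set do under eq_forall do rewrite !mxE.
move=> ->.
  under eq_bigr do rewrite !mxE -mulrBl -natrB// subSnn mul1r.
  by rewrite prodr_const card_ord.
move=> i; rewrite !mxE divr_ge0//; split => //; split.
  by rewrite ler_pM2r ?invr_gt0// ler_nat.
by rewrite ler_pdivrMr// mul1r ler_nat.
Qed.

Lemma prob_unit_cube : P (Y @^-1` @unit_cube R n) = 1%E.
Proof.
have := Y_unif.2 0 (\row_i 1).
under [X in P X = _]eq_set do under eq_forall do rewrite !mxE.
move=> ->; last by move=> i; rewrite !mxE.
by rewrite big1// => i _; rewrite !mxE subr0.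
Qed.

(** The law of [Y] is prescribed on closed boxes only, and a stratum need not be
    one. Each of the [m ^ n] strata is contained in a closed cell of probability
    [m ^- n], and their probabilities add up to 1, which forces equality. *)
Lemma prob_stratum (S : {ffun 'I_n -> 'I_m} -> set 'rV[R]_n) k :
  uniform_cartesian S -> P (Y @^-1` S k) = ((m%:R^-1) ^+ n)%:E.
Proof.
move=> [[mS tS SU] cells].
have le j : (P (Y @^-1` S j) <= ((m%:R^-1) ^+ n)%:E)%E.
  rewrite -(prob_closed_cell j); apply: le_measure; rewrite ?inE.
  - exact: measurable_preimage.
  - have -> : @closed_cell R n m j = [set u : 'rV[R]_n | forall i,
      (\row_i ((j i)%:R / m%:R)) ord0 i <= u ord0 i <=
      (\row_i ((j i).+1%:R / m%:R) : 'rV[R]_n) ord0 i].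
      by apply/seteqP; split => u /= h i; have := h i; rewrite !mxE.
    exact/measurable_preimage_closed/closed_box_closed.
  - by move=> w /=; apply: (cells j).2.
have fin j : P (Y @^-1` S j) = (fine (P (Y @^-1` S j)))%:E.
  by rewrite fineK// fin_num_measure//; exact/measurable_preimage.
have sum1 : \sum_j fine (P (Y @^-1` S j)) = 1.
  apply: EFin_inj; rewrite -prob_unit_cube -SU preimage_bigcup measure_fin_bigcup//.
  - rewrite -sumEFin fsbig_seq ?index_enum_uniq//.
    have -> : [set` index_enum {ffun 'I_n -> 'I_m}] = setT.
      by apply/seteqP; split => j //= _; exact: mem_index_enum.
    by apply: eq_fsbigr => j _; rewrite -fin.
  - exact: finite_finset.
  - apply/trivIsetP => i j _ _ ij; rewrite -preimage_setI.
    by move/trivIsetP : tS => /(_ i j Logic.I Logic.I ij) ->; rewrite preimage_set0.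
  - by move=> j _; exact/measurable_preimage.
have /eqP : \sum_j (m%:R^-1 ^+ n - fine (P (Y @^-1` S j))) = 0.
  rewrite sumrB sum1 sumr_const card_ffun !card_ord -[_ *+ _]mulr_natr natrX.
  by rewrite -exprMn mulVf ?expr1n ?subrr// pnatr_eq0 -lt0n.
rewrite psumr_eq0 => [|j _]; last by rewrite subr_ge0 -lee_fin -fin.
by move=> /allP/(_ k (mem_index_enum k)); rewrite subr_eq0 => /eqP ->; rewrite -fin.
Qed.

End Cells.

(** * Summation over the strata *)

Section HybridVariance.
Variables (d : measure_display) (T : measurableType d) (R : realType).
Variables (P : probability T R) (n : nat) (Y : T -> 'rV[R]_n).
Variables (f : 'rV[R]_n -> R) (I : finType) (S : I -> set 'rV[R]_n).
Variables (A : {set I}) (K : R).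

Let p k := stratum_prob P Y (S k).
Let s k := stratum_sd P Y f (S k).
Let M := \sum_k p k * s k.

Hypotheses (s_le : forall k, s k <= K) (s_eq0 : forall k, k \notin A -> s k = 0).

Let p_ge0 k : 0 <= p k. Proof. by apply: fine_ge0; exact: measure_ge0. Qed.
Let s_ge0 k : 0 <= s k. Proof. exact: sqrtr_ge0. Qed.
Let M_ge0 : 0 <= M. Proof. by apply: sumr_ge0 => k _; exact: mulr_ge0. Qed.
Let rel_ge0 k : 0 <= rel_sd P Y f S k. Proof. exact: (divr_ge0 (s_ge0 k) M_ge0). Qed.
Let denomE (a x : R) : 1 + a * (x - 1) = (1 - a) + a * x. Proof. ring. Qed.

(** The sampling weight is at least [1 - alpha]. *)
Lemma hybrid_variance_le_proportional (N : nat) (alpha : R) : 0 <= alpha < 1 ->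
  hybrid_variance P Y f S N alpha <=
    N%:R^-1 * (K ^+ 2 * (\sum_(k in A) stratum_prob P Y (S k)) / (1 - alpha)).
Proof.
move=> /andP[a0 a1]; rewrite /hybrid_variance ler_wpM2l ?invr_ge0//.
rewrite (bigID (mem A)) /= [X in _ + X]big1 ?addr0 => [|k kA]; last first.
  by rewrite -/(s k) s_eq0// expr0n mulr0 mul0r.
rewrite -mulrA mulr_suml mulr_sumr; apply: ler_sum => k _; rewrite -/(p k) -/(s k).
rewrite denomE mulrA [K ^+ 2 * _]mulrC; apply: ler_pM.
- by rewrite mulr_ge0// sqr_ge0.
- rewrite invr_ge0; apply: addr_ge0; [by rewrite subr_ge0 ltW|exact: mulr_ge0].
- by rewrite ler_wpM2l// lerXn2r// nnegrE// (le_trans (s_ge0 k)).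
- rewrite lef_pV2 ?posrE ?subr_gt0//.
    by rewrite lerDl mulr_ge0.
  apply: ltr_wpDr; [exact: mulr_ge0|by rewrite subr_gt0].
Qed.

(** The sampling weight is at least [alpha * (s k / M)], which turns the summand
    [p k * s k ^+ 2] into [p k * s k * M / alpha]; these sum to [M ^+ 2 / alpha]. *)
Lemma hybrid_variance_le_optimal (N : nat) (alpha : R) : 0 < alpha <= 1 ->
  hybrid_variance P Y f S N alpha <=
    N%:R^-1 * ((K * \sum_(k in A) stratum_prob P Y (S k)) ^+ 2 / alpha).
Proof.
move=> /andP[a0 a1]; rewrite /hybrid_variance ler_wpM2l ?invr_ge0//.
apply: (@le_trans _ _ (M ^+ 2 / alpha)).
  rewrite expr2 {1}/M -mulrA mulr_suml; apply: ler_sum => k _.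
  rewrite -/(p k) -/(s k) denomE.
  (* A vanishing summand must be set apart: its sampling weight can be 0. *)
  have [ps0|ps_neq0] := eqVneq (p k * s k) 0; first by rewrite expr2 !mulrA ps0 !mul0r.
  have ps_gt0 : 0 < p k * s k by rewrite lt_def ps_neq0 mulr_ge0.
  have s_gt0 : 0 < s k.
    rewrite lt_def s_ge0 andbT.
    by apply: contraNneq ps_neq0 => ->; rewrite mulr0.
  have M_gt0 : 0 < M.
    apply: lt_le_trans ps_gt0 _; rewrite /M (bigD1 k)//= lerDl.
    by apply: sumr_ge0 => j _; exact: mulr_ge0.
  have D_gt0 : 0 < 1 - alpha + alpha * rel_sd P Y f S k.
    apply: ltr_wpDl; first by rewrite subr_ge0.
    by apply: mulr_gt0 => //; exact: (divr_gt0 s_gt0 M_gt0).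
  rewrite expr2 mulrA -[leLHS]mulrA ler_pM2l// ler_pdivrMr//.
  rewrite -/(s k) /rel_sd -/(s k) -/M.
  rewrite (_ : M / alpha * _ = s k + M / alpha * (1 - alpha)); last by field; rewrite !gt_eqF.
  by rewrite lerDl mulr_ge0 ?subr_ge0// divr_ge0// ltW.
have M_le : M <= K * \sum_(k in A) p k.
  rewrite /M (bigID (mem A)) /= [X in _ + X]big1 ?addr0 => [|k kA]; last first.
    by rewrite s_eq0// mulr0.
  by rewrite mulr_sumr; apply: ler_sum => k _; rewrite mulrC ler_wpM2r.
by rewrite ler_pM2r ?invr_gt0// lerXn2r ?nnegrE// (le_trans M_ge0).
Qed.

End HybridVariance.

(** * Deviations on the strata of a Cartesian stratification *)

Section Strata.
Variables (d : measure_display) (T : measurableType d) (R : realType).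
Variables (P : probability T R) (n m : nat) (Y : T -> 'rV[R]_n).
Variable S : {ffun 'I_n -> 'I_m} -> set 'rV[R]_n.
Hypotheses (m_gt0 : (0 < m)%N) (Y_unif : uniform_on_cube P Y).
Hypothesis S_unif : uniform_cartesian S.
Implicit Types (k : {ffun 'I_n -> 'I_m}) (f : 'rV[R]_n -> R).

Let m_gt0R : 0 < m%:R :> R. Proof. by rewrite ltr0n. Qed.

Lemma stratum_sub_cube k : S k `<=` @unit_cube R n.
Proof. by have [[_ _ <-] _] := S_unif; exact: bigcup_sup. Qed.

Lemma sum_stratum_prob (A : {set {ffun 'I_n -> 'I_m}}) :
  \sum_(k in A) stratum_prob P Y (S k) = #|A|%:R / #|{ffun 'I_n -> 'I_m}|%:R.
Proof.
under eq_bigr do rewrite /stratum_prob (prob_stratum m_gt0 Y_unif)//.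
by rewrite sumr_const /= card_ffun !card_ord natrX -[LHS]mulr_natl exprVn.
Qed.

Lemma stratum_sd_le f k (c K : R) :
  measurable_fun (Y @^-1` S k) (f \o Y) -> 0 <= K ->
  (forall u, S k u -> (f u - c) ^+ 2 <= K ^+ 2) -> stratum_sd P Y f (S k) <= K.
Proof.
move=> mf K0 fK; rewrite -[leRHS](ger0_norm K0) -sqrtr_sqr ler_wsqrtr//.
apply: (cond_var_le (c := c)) => //.
- by apply: (measurable_preimage Y_unif); have [[mS _ _] _] := S_unif.
- by rewrite (prob_stratum m_gt0 Y_unif)//= exprn_gt0// invr_gt0.
- by move=> w; exact: fK.
Qed.

Definition cell_center k : 'rV[R]_n := \row_i (((k i)%:R + 2^-1) / m%:R).

(** All points of the segment except its end [u] are interior to the cell, hence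
    in the stratum however the faces are distributed. *)
Lemma cell_center_segment k u (t : R) : S k u -> 0 <= t <= 1 ->
  S k (cell_center k + t *: (u - cell_center k)).
Proof.
move=> Su /andP[t0]; rewrite le_eqVlt => /orP[/eqP->|t1].
  by rewrite scale1r subrKC.
apply: (S_unif.2 k).1 => i; have := (S_unif.2 k).2 _ Su i.
rewrite !mxE -natr1 !ler_pdivrMr// !ler_pdivlMr// => /andP[lo hi].
rewrite ltr_pdivrMr// ltr_pdivlMr//.
set x := u ord0 i in lo hi *; set j := (k i)%:R in lo hi *.
rewrite (_ : (_ + _) * _ = (1 - t) * (j + 2^-1) + t * (x * m%:R)); last by field; rewrite gt_eqF.
by apply/andP; split; nra.
Qed.

Lemma cell_center_dist k u : closed_cell k u ->
  dotprod (u - cell_center k) (u - cell_center k) <= n%:R / 4 / m%:R ^+ 2.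
Proof.
move=> cu.
apply: (@le_trans _ _ (\sum_(i < n) 4^-1 / m%:R ^+ 2)); last first.
  by rewrite sumr_const card_ord -[leLHS]mulr_natl mulrA.
apply: ler_sum => i _; have := cu i.
rewrite !mxE -natr1 ler_pdivrMr// ler_pdivlMr// ler_pdivlMr ?exprn_gt0// => /andP[lo hi].
set x := u ord0 i in lo hi *; set j := (k i)%:R in lo hi *.
rewrite (_ : _ * _ * _ = (x * m%:R - j - 2^-1) ^+ 2); last by field; rewrite gt_eqF.
by rewrite expr2; nra.
Qed.

(** Compare [f] with its value at the cell center. The squared distance to the
    center is at most [n / (4 m^2)] pointwise, hence below [n / (3 m^2)]. *)
Lemma stratum_sd_le_C1 f k (C : R) : C1 (@unit_cube R n) f ->
  (forall u, @unit_cube R n u -> norm2 (gradient (@unit_cube R n) f u) ^+ 2 <= C) ->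
  stratum_sd P Y f (S k) <= Num.sqrt (n%:R * C / 3 / m%:R ^+ 2).
Proof.
move=> [grad _] gradC; set U := @unit_cube R n in grad gradC *.
have gradP u : U u -> is_gradient U f u (gradient U f u).
  by move=> Uu; have [g fg] := grad u Uu; exact: (xgetPex 0 (ex_intro _ g fg)).
have C0 : 0 <= C.
  by apply: le_trans (gradC 0 _); rewrite ?sqr_ge0// => i; rewrite mxE lexx ler01.
have K0 : 0 <= n%:R * C / 3 / m%:R ^+ 2.
  by rewrite !mulr_ge0// invr_ge0 ?exprn_ge0// ltW.
apply: (stratum_sd_le (c := f (cell_center k))); last 1 first.
- move=> u Su; rewrite sqr_sqrtr//.
  have [|x Ux ->] := segment_MVT (u := cell_center k) (v := u) gradP.
    by move=> t t01; apply: (@stratum_sub_cube k); exact: cell_center_segment.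
  apply: le_trans (dotprod_Cauchy_Schwarz _ _) _; rewrite -norm2_sqr.
  apply: le_trans (ler_pM (sqr_ge0 _) (dotprod_ge0 _) (gradC x Ux) (cell_center_dist _)) _.
    exact: (S_unif.2 k).2.
  rewrite [C * _]mulrCA -!mulrA ler_wpM2l// !mulrA ler_wpM2r ?invr_ge0 ?exprn_ge0//.
  by rewrite mulrC ler_wpM2l// lef_pV2 ?posrE// ler_nat.
- apply: (measurable_comp_subspace (U := U)) => //.
  + exact: Y_unif.1.
  + by apply/subspace_continuousP => u Uu; exact/is_gradient_continuous/gradP.
  + exact: stratum_sub_cube.
  + by apply: (measurable_preimage Y_unif); have [[mS _ _] _] := S_unif.
- exact: sqrtr_ge0.
Qed.

(** Off [Gamma] the locally constant [f] has gradient 0, so the mean value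
    theorem along the segment to the cell center gives equality. *)
Lemma constant_on_missed_stratum f k Gamma (delta : R) u :
  piecewise_constant (@unit_cube R n) f Gamma delta -> ~ (S k `&` Gamma !=set0) ->
  S k u -> f u = f (cell_center k).
Proof.
move=> [_ loc _] missed Su; apply/eqP; rewrite -subr_eq0.
have [|t t01|x _ ->] := @segment_MVT _ _ (S k) f (fun=> 0) (cell_center k) u.
- move=> x Sx; apply/is_gradientP => e e0.
  have UGamma v : S k v -> (@unit_cube R n `\` Gamma) v.
    by move=> Sv; split; [exact: stratum_sub_cube Sv|move=> Gv; apply: missed; exists v].
  have := loc x (UGamma x Sx); rewrite !near_withinE.
  apply: filterS => v + Sv; move=> /(_ (UGamma v Sv)) ->.
  rewrite subrr /dotprod big1 ?subrr ?normr0 ?mulr_ge0 ?(ltW e0)// => i _.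
  by rewrite mxE mul0r.
- exact: cell_center_segment.
- by rewrite /dotprod big1// => i _; rewrite mxE mul0r.
Qed.

Lemma stratum_sd_piecewise_constant f Gamma (delta : R) k :
  0 < delta -> piecewise_constant (@unit_cube R n) f Gamma delta ->
  measurable_fun (Y @^-1` @unit_cube R n) (f \o Y) ->
  stratum_sd P Y f (S k) <= delta / 2 /\
  (k \notin hit_strata S Gamma -> stratum_sd P Y f (S k) = 0).
Proof.
move=> d0 pw mf.
have mfk : measurable_fun (Y @^-1` S k) (f \o Y).
  apply: measurable_funS mf; last by move=> w; exact: stratum_sub_cube.
  apply: (measurable_preimage Y_unif); have [[mS _ <-] _] := S_unif.
  by apply: fin_bigcup_measurable => //; exact: finite_finset.
split.
  have [_ _ [a [b [ab fU]]]] := pw.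
  (* Both values of [f] are at distance exactly [delta / 2] from their midpoint. *)
  apply: (stratum_sd_le (c := (a + b) / 2)) => //; first by rewrite divr_ge0// ltW.
  move=> u Su; rewrite -ab exprMn real_normK ?num_real//.
  have : (f @` @unit_cube R n) (f u) by exists u => //; exact: stratum_sub_cube Su.
  rewrite fU => -[->|->]; rewrite -subr_ge0 le_eqVlt; apply/orP; left; apply/eqP; by field.
rewrite inE => /asboolPn missed.
apply/eqP; rewrite eq_le sqrtr_ge0 andbT.
apply: (stratum_sd_le (c := f (cell_center k))) => // u Su.
by rewrite (constant_on_missed_stratum pw missed Su) subrr.
Qed.

End Strata.

(** * The supremum of the gradient on the cube *)

Lemma unit_cube_compact (R : realType) (n : nat) : compact (@unit_cube R n).
Proof.
have := @rV_compact R n (fun=> `[0, 1]%classic) (fun=> @segment_compact R 0 1).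
congr compact; apply/seteqP; split => u /= h i; have := h i; by rewrite /= in_itv.
Qed.

Lemma unit_cube0 (R : realType) (n : nat) : @unit_cube R n 0.
Proof. by move=> i; rewrite mxE lexx ler01. Qed.

(** Without this bound the suprema in [sup_grad2] and [C1_norm] would be the
    default value 0 instead of upper bounds. *)
Lemma norm2_gradient_bounded (R : realType) (n : nat) (f : 'rV[R]_n -> R) :
  C1 (@unit_cube R n) f ->
  exists M : R, forall u, @unit_cube R n u ->
    norm2 (gradient (@unit_cube R n) f u) ^+ 2 <= M.
Proof.
move=> [_ cont]; set U := @unit_cube R n in cont *.
have [|c _ cmax] := @compact_EVT_max _ R (fun u => dotprod (gradient U f u) (gradient U f u)) U
    (ex_intro _ 0 (@unit_cube0 R n)) (@unit_cube_compact R n).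
  apply/subspace_continuousP => u Uu; move/subspace_continuousP : cont => /(_ u Uu) gu.
  exact: cvg_dotprod.
exists (dotprod (gradient U f c) (gradient U f c)) => u Uu.
by rewrite norm2_sqr; apply: cmax; rewrite inE.
Qed.

Lemma sup_grad2_ub (R : realType) (n : nat) (f : 'rV[R]_n -> R) u :
  C1 (@unit_cube R n) f -> @unit_cube R n u ->
  norm2 (gradient (@unit_cube R n) f u) ^+ 2 <= sup_grad2 (@unit_cube R n) f.
Proof.
move=> /norm2_gradient_bounded[M gM] Uu.
apply: sup_upper_bound; last by exists u.
split; first by exists (norm2 (gradient (@unit_cube R n) f u) ^+ 2), u.
by exists M => _ [v Uv <-]; exact: gM.
Qed.

Lemma sup_grad2_le_C1_norm (R : realType) (n : nat) (f : 'rV[R]_n -> R) :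
  C1 (@unit_cube R n) f ->
  sup_grad2 (@unit_cube R n) f <= C1_norm (@unit_cube R n) f ^+ 2.
Proof.
move=> C1f; set U := @unit_cube R n in C1f *.
have supf_ge0 : 0 <= sup [set `|f u| | u in U].
  (* The supremum of an unbounded set is 0 by convention. *)
  have [fsup|/sup_out ->//] := pselect (has_sup [set `|f u| | u in U]).
  apply: (@le_trans _ _ `|f 0|) => //; apply: sup_upper_bound => //.
  by exists 0 => //; exact: unit_cube0.
apply: ge_sup => [|_ [u Uu <-]].
  by exists (norm2 (gradient U f 0) ^+ 2), 0 => //; exact: unit_cube0.
have le : norm2 (gradient U f u) <= sup [set norm2 (gradient U f v) | v in U].
  have [M gM] := norm2_gradient_bounded C1f.
  apply: sup_upper_bound; last by exists u.
  split; first by exists (norm2 (gradient U f u)), u.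
  exists (Num.sqrt M) => _ [v Uv <-].
  by rewrite -[leLHS]ger0_norm ?sqrtr_ge0// -sqrtr_sqr ler_wsqrtr// gM.
rewrite lerXn2r ?nnegrE ?sqrtr_ge0//; last by rewrite (le_trans le)// lerDr.
by rewrite addr_ge0// (le_trans _ le)// sqrtr_ge0.
Qed.

(** * The bounds for all allocations *)

(** One of [alpha] and [1 - alpha] is at least 1/2, and the larger one has the
    smaller inverse; so the minimum is finite and the infinite inverse at
    [alpha = 0] or [alpha = 1] is never the one selected. *)
Lemma mine_inverses_finite (R : realType) (alpha : R) : 0 <= alpha <= 1 ->
  exists2 r : R, mine (alpha%:E)^-1%E ((1 - alpha)%:E)^-1%E = r%:E &
    [/\ r <= 2, (r = alpha^-1 /\ 0 < alpha) \/ (r = (1 - alpha)^-1 /\ alpha < 1)  & 0 <= r].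
Proof.
move=> /andP[a0 a1]; have [ah|ah] := leP alpha 2^-1.
  have a1_gt0 : 0 < 1 - alpha by lra.
  exists (1 - alpha)^-1.
    rewrite min_r !inver [1 - _ == _]gt_eqF//; case: eqVneq => [_|aN0]; first exact: leey.
    by rewrite lee_fin lef_pV2 ?posrE ?lt_def ?aN0//; lra.
  split; last by rewrite invr_ge0 ltW.
    by rewrite invf_ple ?posrE//; lra.
  by right; split => //; lra.
have a_gt0 : 0 < alpha by lra.
exists alpha^-1.
  rewrite min_l !inver [alpha == _]gt_eqF//; case: eqVneq => [_|aN1]; first exact: leey.
  have a1_gt0 : 0 < 1 - alpha by rewrite lt_def aN1 subr_ge0.
  by rewrite lee_fin lef_pV2 ?posrE//; lra.
split; last by rewrite invr_ge0 ltW.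
  by rewrite invf_ple ?posrE//; lra.
by left.
Qed.

Unset Implicit Arguments.

Theorem lemma3 (R : realType) (d : measure_display) (T : measurableType d)
    (P : probability T R) (n m N : nat) (n_gt0 : (0 < n)%N) (m_gt0 : (0 < m)%N)
    (N_gt0 : (0 < N)%N) (Y : T -> 'rV[R]_n) (Y_unif : uniform_on_cube P Y)
    (S : {ffun 'I_n -> 'I_m} -> set 'rV[R]_n) (S_unif : uniform_cartesian S) :
  let U := @unit_cube R n in
  let cardS : R := #|{ffun 'I_n -> 'I_m}|%:R in
  (* (i) *)
  (forall f : 'rV[R]_n -> R, C1 U f ->
     let C := sup_grad2 U f in
     let B := cardS `^ (- (2 / n%:R)) in
     (forall alpha : R, 0 <= alpha <= 1 ->
        ((hybrid_variance P Y f S N alpha)%:E <=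
           (n%:R * C / (3 * N%:R) * B)%:E *
           mine (alpha%:E)^-1 ((1 - alpha)%:E)^-1)%E /\
        ((n%:R * C / (3 * N%:R) * B)%:E *
           mine (alpha%:E)^-1 ((1 - alpha)%:E)^-1 <=
           (2 * n%:R * C / (3 * N%:R) * B)%:E)%E) /\
     C <= C1_norm U f ^+ 2) /\
  (* (ii) *)
  (forall (f : 'rV[R]_n -> R) (Gamma : set 'rV[R]_n) (delta : R),
     0 < delta -> piecewise_constant U f Gamma delta ->
     measurable_fun (Y @^-1` U) (f \o Y) ->
     let r : R := #|hit_strata S Gamma|%:R / cardS in
     forall alpha : R, 0 <= alpha <= 1 ->
       hybrid_variance P Y f S N alpha <=
         delta ^+ 2 / (4 * N%:R) *
         (if alpha == 0 then r
          else if alpha == 1 then r ^+ 2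
          else r * Num.min (1 - alpha)^-1 (alpha^-1 * r))).
Proof.
move=> U cardS.
have m_neq0 : m%:R != 0 :> R by rewrite pnatr_eq0 -lt0n.
have N_neq0 : N%:R != 0 :> R by rewrite pnatr_eq0 -lt0n.
have sum_prob (A : {set {ffun 'I_n -> 'I_m}}) :
    \sum_(k in A) stratum_prob P Y (S k) = #|A|%:R / cardS.
  exact: sum_stratum_prob.
split => [f C1f C B|f Gamma delta d0 pw mf r alpha /andP[a0 a1]].
  split; last exact: sup_grad2_le_C1_norm.
  have C0 : 0 <= C.
    exact: le_trans (sqr_ge0 _) (sup_grad2_ub C1f (@unit_cube0 R n)).
  have B_eq : B = (m%:R ^+ 2)^-1.
    rewrite /B /cardS card_ffun !card_ord natrX powRN; congr (_^-1).
    rewrite -powR_mulrn// -powRrM mulrC divfK ?powR_mulrn// pnatr_eq0 -lt0n//.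
  have B0 : 0 <= B by rewrite B_eq invr_ge0 exprn_ge0.
  (* Every stratum may vary here, so the summation bounds are used with all
     strata and total probability 1. *)
  set K := Num.sqrt (n%:R * C / 3 / m%:R ^+ 2).
  have K_sqr : K ^+ 2 = n%:R * C / 3 * B.
    by rewrite sqr_sqrtr -?B_eq// !mulr_ge0.
  have sd_le k : stratum_sd P Y f (S k) <= K.
    by apply: stratum_sd_le_C1 => // u Uu; exact: sup_grad2_ub.
  have sd_out k : k \notin [set: {ffun 'I_n -> 'I_m}]%SET -> stratum_sd P Y f (S k) = 0.
    by rewrite inE.
  have sum1 : \sum_(k in [set: {ffun 'I_n -> 'I_m}]%SET) stratum_prob P Y (S k) = 1.
    by rewrite sum_prob cardsT divff// /cardS card_ffun !card_ord natrX expf_neq0.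
  move=> alpha a01; have [q -> [q2 qE q0]] := mine_inverses_finite a01.
  split; rewrite -EFinM lee_fin.
    rewrite (_ : _ * _ = N%:R^-1 * (K ^+ 2 * q)); last by rewrite K_sqr; field.
    move/andP : a01 => [a0 a1].
    case: qE => -[-> ha].
      apply: le_trans (hybrid_variance_le_optimal sd_le sd_out _ _) _.
        by rewrite ha.
      by rewrite sum1 mulr1.
    apply: le_trans (hybrid_variance_le_proportional sd_le sd_out _ _) _.
      by rewrite a0.
    by rewrite sum1 mulr1.
  rewrite (_ : 2 * n%:R * C / (3 * N%:R) * B = n%:R * C / (3 * N%:R) * B * 2); last by field.
  by rewrite ler_wpM2l// !mulr_ge0// invr_ge0 mulr_ge0.
have sd k := stratum_sd_piecewise_constant m_gt0 Y_unif S_unif k d0 pw mf.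
have sd_le k : stratum_sd P Y f (S k) <= delta / 2 by have [] := sd k.
have sd_out k : k \notin hit_strata S Gamma -> stratum_sd P Y f (S k) = 0 by have [] := sd k.
have bound0 : alpha < 1 -> hybrid_variance P Y f S N alpha <=
    delta ^+ 2 / (4 * N%:R) * (r * (1 - alpha)^-1).
  move=> ha; apply: le_trans (hybrid_variance_le_proportional sd_le sd_out _ _) _.
    by rewrite a0.
  by rewrite sum_prob -/r le_eqVlt; apply/orP; left; apply/eqP; field; rewrite N_neq0; lra.
have bound1 : 0 < alpha -> hybrid_variance P Y f S N alpha <=
    delta ^+ 2 / (4 * N%:R) * (r * (alpha^-1 * r)).
  move=> ha; apply: le_trans (hybrid_variance_le_optimal sd_le sd_out _ _) _.
    by rewrite ha.
  by rewrite sum_prob -/r le_eqVlt; apply/orP; left; apply/eqP; field; rewrite N_neq0 gt_eqF.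
have [a_eq0|aN0] := eqVneq alpha 0.
  by have := bound0; rewrite a_eq0 subr0 invr1 mulr1; apply.
have a_gt0 : 0 < alpha by rewrite lt_def aN0.
have [a_eq1|aN1] := eqVneq alpha 1.
  by have := bound1 a_gt0; rewrite a_eq1 invr1 mul1r expr2.
have a_lt1 : alpha < 1 by rewrite lt_neqAle aN1.
by rewrite minEle; case: ifP => _; [exact: bound0|exact: bound1].
Qed.
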